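(* Let $\mathcal{T}_1,\mathcal{T}_2\in\mathbf{HC}(\mathbb{S}^d)$ be two hyper projection operators. Then the product $\mathcal{T}_1\mathcal{T}_2$ (composition) is also a hyper projection operator if and only if $\mathcal{T}_1$ and $\mathcal{T}_2$ commute, i.e. $\mathcal{T}_1\mathcal{T}_2=\mathcal{T}_2\mathcal{T}_1$.
   Context: Let $d\ge2$ and let $\mathbb{S}^d\subset\mathbb{R}^{d+1}$ be the unit sphere with Lebesgue surface measure $\mathrm{d}\omega_d$. $\mathcal{C}(\mathbb{S}^d)$ is the space of real continuous functions on $\mathbb{S}^d$; $\mathbb{P}_n(\mathbb{S}^d)$ is the space of restrictions to $\mathbb{S}^d$ of real polynomials of total degree at most $n$. For each $\ell\ge0$, $\{Y^{(d)}_{\ell k}:k=1,\dots,Z(d,\ell)\}$ is a fixed real $L_2(\mathbb{S}^d)$-orthonormal basis of the space of real spherical harmonics of degree $\ell$ (restrictions to $\mathbb{S}^d$ of real harmonic homogeneous polynomials of degree $\ell$), whose dimension is $Z(d,\ell)$. Fix a quadrature rule with nodes $\mathbf{x}_1,\dots,\mathbf{x}_N\in\mathbb{S}^d$ and positive weights $w_1,\dots,w_N$. It has exactness $m$ if $\sum_{j=1}^N w_jp(\mathbf{x}_j)=\int_{\mathbb{S}^d}p\,\mathrm{d}\omega_d$ for all $p\in\mathbb{P}_m(\mathbb{S}^d)$. Put $\langle f,g\rangle_N=\sum_{j=1}^N w_jf(\mathbf{x}_j)g(\mathbf{x}_j)$ for $f,g\in\mathcal{C}(\mathbb{S}^d)$.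 Hyperinterpolation class $\mathbf{HC}(\mathbb{S}^d)$: the operators $\mathcal{T}:\mathcal{C}(\mathbb{S}^d)\to\mathbb{P}_n(\mathbb{S}^d)$, for some $n$ such that the quadrature rule has exactness $2n$, of the form $\mathcal{T}f=\sum_{\ell=0}^n\sum_{k=1}^{Z(d,\ell)}\Phi\big(\langle f,Y^{(d)}_{\ell k}\rangle_N\big)Y^{(d)}_{\ell k}$, where $\Phi:\mathbb{R}\to\mathbb{R}$ is a (possibly nonlinear, possibly $(\ell,k)$-dependent) function, for which there exists $c_d>0$, independent of $n$, with $\|\mathcal{T}f\|_{L_2(\mathbb{S}^d)}\le c_d\|f\|_\infty$ for all $f\in\mathcal{C}(\mathbb{S}^d)$. (For a single operator this is the existence of a finite constant; independence of $n$ concerns families indexed by $n$.) Different operators may have different degrees $n$; the quadrature rule is the same. Operators are composed and added as maps $\mathcal{C}(\mathbb{S}^d)\to\mathcal{C}(\mathbb{S}^d)$. An operator $\mathcal{T}$ on $\mathcal{C}(\mathbb{S}^d)$ is hyper self-adjoint if $\langle\mathcal{T}f,g\rangle_N=\langle f,\mathcal{T}g\rangle_N$ for all $f,g\in\mathcal{C}(\mathbb{S}^d)$. It is a hyper projection operator if it is hyper self-adjoint and $\mathcal{T}^2=\mathcal{T}$. *)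

(* Defs.v *)
From HB Require Import structures.
From mathcomp Require Import all_boot all_order all_algebra.
From mathcomp Require Import all_classical all_reals all_analysis.
From mathcomp Require Import measurable_realfun.
(* mpoly is not imported in full: its notations clash with those of
   mathcomp-analysis. *)
From mathcomp Require mpoly.
Import (canonicals, coercions) mpoly.
Set Implicit Arguments.
Unset Strict Implicit.
Unset Printing Implicit Defensive.
Import Order.TTheory GRing.Theory Num.Theory.
Import numFieldNormedType.Exports.

Local Open Scope classical_set_scope.
Local Open Scope ring_scope.

Section lebesgue_cons.
Context (R : realType) (n : nat).
Local Notation mR := (measurableTypeR R).
Variable m : {sigma_finite_measure set (n.-tuple mR) -> \bar R}.

Definition tuple_cons (p : mR * n.-tuple mR) : n.+1.-tuple mR :=
  [the n.+1.-tuple mR of p.1 :: p.2].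

Lemma measurable_tuple_cons : measurable_fun setT tuple_cons.
Proof. exact: measurable_cons. Qed.

Definition lebesgue_cons : set (n.+1.-tuple mR) -> \bar R :=
  pushforward (@lebesgue_measure R \x m)%E tuple_cons.

Let lebesgue_cons0 : lebesgue_cons set0 = 0%E.
Proof. by rewrite /lebesgue_cons /pushforward preimage_set0 measure0. Qed.

Let lebesgue_cons_ge0 A : (0 <= lebesgue_cons A)%E.
Proof. by rewrite /lebesgue_cons /pushforward; apply: measure_ge0. Qed.

Let lebesgue_cons_sigma_additive : semi_sigma_additive lebesgue_cons.
Proof.
exact: (@measure_semi_sigma_additive _ _ _
  (measure_function_pushforward__canonical__measure_function_Measure
    (@lebesgue_measure R \x m)%E measurable_tuple_cons)).
Qed.

HB.instance Definition _ := isMeasure.Build _ _ _ lebesgue_cons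
  lebesgue_cons0 lebesgue_cons_ge0 lebesgue_cons_sigma_additive.

Let lebesgue_cons_sigma_finite : sigma_finite setT lebesgue_cons.
Proof.
have /sigma_finiteP[F [TF ndF Foo]] := sigma_finiteT (@lebesgue_measure R).
have /sigma_finiteP[G [TG ndG Goo]] := sigma_finiteT m.
pose B k := [set t : n.+1.-tuple mR | F k (thead t) /\
  G k [tuple of behead t]].
exists B => [|k].
  apply/seteqP; split => // t _.
  have [i _ Fi] : (\bigcup_k F k) (thead t) by rewrite -TF.
  have [j _ Gj] : (\bigcup_k G k) [tuple of behead t] by rewrite -TG.
  exists (maxn i j) => //; split.
  - by move: Fi; exact/subsetPset/ndF/leq_maxl.
  - by move: Gj; exact/subsetPset/ndG/leq_maxr.
have [mF Fk] := Foo k; have [mG Gk] := Goo k; split.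
  apply: measurableI.
    rewrite -[X in measurable X]setTI.
    by apply: (@measurable_tnth _ mR _ ord0) => //.
  rewrite -[X in measurable X]setTI.
  exact: (@measurable_behead _ mR).
rewrite /lebesgue_cons /pushforward.
rewrite (_ : _ @^-1` _ = F k `*` G k); last first.
  have thE (x : mR) (t : n.-tuple mR) : thead (tuple_cons (x, t)) = x by [].
  have tlE (x : mR) (t : n.-tuple mR) : [tuple of behead (tuple_cons (x, t))] = t.
    exact/val_inj.
  by apply/seteqP; split => -[x t]; rewrite /B/preimage/=; rewrite thE tlE.
by rewrite product_measure1E// lte_mul_pinfty// ge0_fin_numE.
Qed.

HB.instance Definition _ := Measure_isSigmaFinite.Build _ _ _ lebesgue_cons
  lebesgue_cons_sigma_finite.

End lebesgue_cons.

Fixpoint lebesgue_tuple (R : realType) (n : nat) :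
    {sigma_finite_measure set (n.-tuple (measurableTypeR R)) -> \bar R} :=
  match n return
    {sigma_finite_measure set (n.-tuple (measurableTypeR R)) -> \bar R} with
  | 0 => \d_[tuple]
  | n'.+1 => lebesgue_cons (lebesgue_tuple R n')
  end.

Definition unit_sphere (R : realType) (d : nat) : set 'rV[R]_d.+1 :=
  [set x | \sum_i x ord0 i ^+ 2 = 1].
Arguments unit_sphere : clear implicits.

Definition sphere (R : realType) (d : nat) : Type := unit_sphere R d.

Section sphere_structures.
Context (R : realType) (d : nat).

HB.instance Definition _ := SubChoice.copy (sphere R d) (set_type (unit_sphere R d)).
HB.instance Definition _ := Topological.on (sphere R d).

Definition sphere_coord (x : sphere R d) (i : 'I_d.+1) : R := \val x ord0 i.

Lemma pole_subproof : delta_mx ord0 ord0 \in unit_sphere R d.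
Proof.
rewrite inE /unit_sphere/= (bigD1 ord0)//= mxE !eqxx expr1n big1 ?addr0//.
by move=> i i0; rewrite mxE (negbTE i0) expr0n.
Qed.

Definition pole : sphere R d :=
  exist (fun x => x \in unit_sphere R d) _ pole_subproof.

HB.instance Definition _ := isPointed.Build (sphere R d) pole.

HB.instance Definition _ := Measurable.copy (sphere R d)
  (g_sigma_algebraType (@open (sphere R d))).

End sphere_structures.

Section surface_measure.
Context (R : realType) (d : nat).
Local Notation mR := (measurableTypeR R).
Local Notation space := (d.+1.-tuple mR).

Definition enorm (t : space) : R := Num.sqrt (\sum_i tnth t i ^+ 2).

(* [insubd] returns [pole R d] when [t = 0] *)
Definition normalize (t : space) : sphere R d :=
  insubd (pole R d) (\row_i (tnth t i / enorm t)).

Definition punctured_ball : set space := [set t | 0 < enorm t <= 1].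

Lemma measurable_tuple_coord i : measurable_fun setT (fun t : space => tnth t i : R).
Proof. exact: (@measurable_tnth _ mR). Qed.

Lemma measurable_enorm : measurable_fun setT enorm.
Proof.
apply: (@measurableT_comp _ _ _ _ _ _ (@Num.sqrt R)).
  by apply: continuous_measurable_fun; exact: sqrt_continuous.
apply: measurable_sum => i; apply: measurable_funX; exact: measurable_tuple_coord.
Qed.

Lemma measurable_punctured_ball : measurable punctured_ball.
Proof.
rewrite -[X in measurable X]setTI.
have -> : punctured_ball = enorm @^-1` `]0, 1].
  by apply/seteqP; split => t /=; rewrite in_itv.
exact: measurable_enorm.
Qed.

Lemma measurable_row_open (f : 'I_d.+1 -> space -> R) (W : set 'rV[R]_d.+1) :
  (forall i, measurable_fun setT (f i)) -> open W ->
  measurable [set t | W (\row_i f i t)].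
Proof.
move=> mf oW.
pose box (p : 'rV[rat]_d.+1 * nat) : set 'rV[R]_d.+1 :=
  [set v | forall i, `|ratr (p.1 ord0 i) - v ord0 i| < p.2.+1%:R^-1].
pose B p : set space := if `[< box p `<=` W >] then
  \bigcap_(i in [set: 'I_d.+1]) f i @^-1`
    ball (ratr (p.1 ord0 i) : R) p.2.+1%:R^-1 else set0.
have -> : [set t | W (\row_i f i t)] = \bigcup_p B p.
  apply/seteqP; split=> [t /= Wt|t [p _]]; last first.
    rewrite /B; case: asboolP => // pW ft; apply: pW => i.
    by rewrite mxE; exact: (ft i).
  have /nbhs_ballP[e /= e0 eW] : nbhs (\row_i f i t) W by exact: open_nbhs_nbhs.
  have [k ke] : exists k : nat, k.+1%:R^-1 < e / 2.
    have e20 : 0 < e / 2 by rewrite divr_gt0.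
    have [k _ /(_ k (leqnn k))/=] := near_infty_natSinv_lt (PosNum e20).
    by exists k.
  have qP i : exists q : rat, `|ratr q - f i t| < k.+1%:R^-1 :> R.
    have [||x [fx [q _ qx]]] := @dense_rat R (ball (f i t) k.+1%:R^-1).
    - by exists (f i t); exact: ballxx.
    - exact: ball_open.
    by exists q; rewrite qx distrC.
  have [q qE] := choice qP.
  exists (\row_i q i, k) => //; rewrite /B; case: asboolP => [_ i _|[]] /=.
    by rewrite mxE; exact: qE.
  move=> v /= bv; apply: eW; split => // i j; rewrite ord1 !mxE.
  suff: `|f j t - v ord0 j| < e by [].
  have -> : f j t - v ord0 j = (f j t - ratr (q j)) + (ratr (q j) - v ord0 j).
    by rewrite addrA subrK.
  apply: (le_lt_trans (ler_normD _ _)); rewrite (splitr e) ltrD//.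
    by rewrite distrC; exact: lt_trans (qE j) ke.
  by have := bv j; rewrite mxE => /lt_trans; exact.
apply: countable_bigcupT_measurable => [|p]; first exact: countableP.
rewrite /B; case: asboolP => // _.
apply: fin_bigcap_measurable => // i _.
rewrite -[X in measurable X]setTI; apply: mf => //.
exact: measurable_ball.
Qed.

Lemma measurable_normalize : measurable_fun setT normalize.
Proof.
apply: (@measurability _ _ _ _ _ _ (@open (sphere R d))) => //.
move=> _ [_ [W oW <-] <-]; rewrite setTI.
pose g i (t : space) : R := tnth t i * enorm t `^ (-1).
have mg i : measurable_fun setT (g i).
  apply: measurable_funM; first exact: measurable_tuple_coord.
  exact: (measurableT_comp (measurable_powR (-1)) measurable_enorm).
have gE t : \row_i (tnth t i / enorm t) = \row_i g i t.
  by apply/rowP => i; rewrite !mxE /g powR_inv1// sqrtr_ge0.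
pose Z := [set t : space | \row_i g i t \in unit_sphere R d].
have mZ : measurable Z.
  rewrite /Z.
  rewrite (_ : [set _ | _] = (fun t => \sum_i g i t ^+ 2) @^-1` [set 1%R]).
    rewrite -[X in measurable X]setTI.
    have /(_ measurableT [set 1%R]) := @measurable_sum _ _ R setT _
      (index_enum 'I_d.+1) (fun i t => g i t ^+ 2)
      (fun i => measurable_funX 2 (mg i)).
    by apply; exact: measurable_set1.
  have sE t : \sum_i (\row_i g i t) ord0 i ^+ 2 = \sum_i g i t ^+ 2.
    by apply: eq_bigr => i _; rewrite mxE.
  by apply/seteqP; split => t /=; rewrite inE /unit_sphere /= sE.
have -> : normalize @^-1` (\val @^-1` W) = 
    (Z `&` [set t | W (\row_i g i t)]) `|`
    (~` Z `&` [set t | W (\val (pole R d))]).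
  apply/seteqP; split => t /=; rewrite /normalize val_insubd gE.
    case: ifPn => [h Wt|h Wt]; first by left.
    by right; split => //; apply/negP.
  by case: ifPn => [h [[]//|[]//]|/negP h [[]//|[]//]].
apply: measurableU; apply: measurableI => //.
- exact: measurable_row_open.
- exact: measurableC.
- have [Wp|nWp] := pselect (W (\val (pole R d))).
    by rewrite (_ : mkset _ = setT)//; apply/seteqP; split.
  by rewrite (_ : mkset _ = set0)//; apply/seteqP; split.
Qed.

(* By integration in polar coordinates, the surface measure of [A] is [d.+1]
   times the Lebesgue measure of the cone over [A] in the unit ball. *)
Definition surface_measure (A : set (sphere R d)) : \bar R :=
  (d.+1%:R%:E *
   lebesgue_tuple R d.+1 (normalize @^-1` A `&` punctured_ball))%E.

Let pushforward_ball :=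
  measure_function_pushforward__canonical__measure_function_Measure
  (mrestr (lebesgue_tuple R d.+1) measurable_punctured_ball)
  measurable_normalize.

Let surface_measureE : surface_measure = mscale d.+1%:R%:nng pushforward_ball.
Proof. by []. Qed.

Let surface_measure0 : surface_measure set0 = 0%E.
Proof. by rewrite surface_measureE measure0. Qed.

Let surface_measure_ge0 A : (0 <= surface_measure A)%E.
Proof. by rewrite surface_measureE measure_ge0. Qed.

Let surface_measure_sigma_additive : semi_sigma_additive surface_measure.
Proof. rewrite surface_measureE; exact: measure_semi_sigma_additive. Qed.

HB.instance Definition _ := isMeasure.Build _ _ _ surface_measure
  surface_measure0 surface_measure_ge0 surface_measure_sigma_additive.

End surface_measure.

Notation cfun R d := (continuousType (sphere R d) R).

Definition laplacian (R : realType) (n : nat) (p : mpoly.mpoly n R) :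
    mpoly.mpoly n R :=
  \sum_(i < n) mpoly.mderiv i (mpoly.mderiv i p).

Section polynomial_spaces.
Context (R : realType) (d : nat).
Implicit Type f : sphere R d -> R.

(* [mmeasure mdeg p] is one more than the total degree of [p], and [0] if
   [p = 0]. *)
Definition poly_space (n : nat) : set (sphere R d -> R) :=
  [set f | exists2 p : mpoly.mpoly d.+1 R,
    (mpoly.mmeasure mpoly.mdeg p <= n.+1)%N &
    forall u, f u = mpoly.meval (sphere_coord u) p].

Definition harmonic_space (l : nat) : set (sphere R d -> R) :=
  [set f | exists p : mpoly.mpoly d.+1 R,
    [/\ p \is mpoly.ishomog1 l mpoly.mdeg, laplacian p = 0 &
        forall u, f u = mpoly.meval (sphere_coord u) p]].

(* Linear independence follows from orthonormality. *)
Definition orthonormal_harmonic_basis (l z : nat) (Y : 'I_z -> cfun R d) :=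
  [/\ forall k, harmonic_space l (Y k),
      forall k k',
        \int[@surface_measure R d]_u (Y k u * Y k' u) = (k == k')%:R &
      forall f, harmonic_space l f ->
        exists c : 'I_z -> R, forall u, f u = \sum_(k < z) c k * Y k u].

End polynomial_spaces.

Definition sup_norm (R : realType) (d : nat) (f : cfun R d) : R :=
  sup [set `|f u| | u in [set: sphere R d]].

Definition L2_norm (R : realType) (d : nat) (f : cfun R d) : \bar R :=
  ('N[@surface_measure R d]_2%:E[EFin \o f])%E.

Section hyperinterpolation.
Context (R : realType) (d N : nat).
Variables (x : 'I_N -> sphere R d) (w : 'I_N -> R).

Definition exactness (m : nat) : Prop :=
  forall p, poly_space m p ->
    \sum_(j < N) w j * p (x j) = \int[@surface_measure R d]_u p u.

Definition discrete_inner (f g : cfun R d) : R :=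
  \sum_(j < N) w j * f (x j) * g (x j).

Definition hyperinterpolation_class (Z : nat -> nat)
    (Y : forall l, 'I_(Z l) -> cfun R d) (T : cfun R d -> cfun R d) : Prop :=
  exists (n : nat) (Phi : forall l, 'I_(Z l) -> R -> R),
    [/\ exactness (2 * n)%N,
        forall f, poly_space n (T f),
        forall f u, T f u = \sum_(l < n.+1) \sum_(k < Z l)
          Phi l k (discrete_inner f (Y l k)) * Y l k u &
        exists2 c : R, 0 < c &
          forall f, (L2_norm (T f) <= (c * sup_norm f)%:E)%E].

Definition hyper_self_adjoint (T : cfun R d -> cfun R d) : Prop :=
  forall f g, discrete_inner (T f) g = discrete_inner f (T g).

Definition hyper_projection (T : cfun R d -> cfun R d) : Prop :=
  hyper_self_adjoint T /\ T \o T = T.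

End hyperinterpolation.

(* Main.v *)
Require Import Defs.
From mathcomp Require Import all_boot all_order all_algebra.
From mathcomp Require Import all_classical all_reals all_analysis.
From mathcomp Require Import measurable_realfun.
From mathcomp Require Import ring.
From mathcomp Require mpoly.
Import (canonicals, coercions) mpoly.
Import Order.TTheory GRing.Theory Num.Theory.
Import numFieldNormedType.Exports.
Local Open Scope classical_set_scope.
Local Open Scope ring_scope.

(** If [T1] and [T2] commute, then self-adjointness and idempotence of
    [T1 \o T2] are formal, as for projections in a Hilbert space.

    Conversely, suppose that [T1 \o T2] is self-adjoint, fix [g], and put
    [a := T1 (T2 g)] and [b := T2 (T1 g)].  Moving the operators across the
    discrete form shows that [discrete_inner f a = discrete_inner f b] for
    every [f].  The discrete form is only a semi-inner product on continuous
    functions (it sees nothing but the nodes), so this alone does not give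
    [a = b]; it gives [discrete_inner (a - b) (a - b) = 0].  But [a] and [b]
    are polynomials, of degrees [n1] and [n2] say, and the rule integrates
    exactly all polynomials of degree [2 * maxn n1 n2], hence [(a - b) ^+ 2].
    Therefore [(a - b) ^+ 2] has integral zero over the sphere
    ([poly_space_sqr_sub]).

    It remains to conclude that [a = b] ([integral_sqr_sub_eq0]).  Here two
    analytic facts enter.  The real-valued integral sends an infinite integral
    to [0], so the integral has to be known to be finite: this is where the
    bounds on the [L2] norms of the operators in the class are used.  And a
    continuous function that vanishes almost everywhere vanishes everywhere,
    because the surface measure charges every nonempty open set
    ([surface_measure_open_gt0]): the part of the unit ball lying over an open
    piece of the sphere contains a small cube. *)

(** * Cubes in Euclidean space *)

Definition cube {R : realType} {n : nat} (a : 'I_n -> R) (e : R) :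
    set (n.-tuple (measurableTypeR R)) :=
  [set t | forall i, ball (a i) e (tnth t i)].

Lemma measurable_cube (R : realType) (n : nat) (a : 'I_n -> R) (e : R) :
  measurable (cube a e).
Proof.
rewrite (_ : cube a e = \bigcap_(i in [set: 'I_n])
    (fun t : n.-tuple (measurableTypeR R) => tnth t i : R) @^-1` ball (a i) e).
  apply: fin_bigcap_measurable => // i _.
  rewrite -[X in measurable X]setTI.
  apply: (@measurable_tnth _ (measurableTypeR R) _ i) => //.
  exact: measurable_ball.
by apply/seteqP; split => [t /= ta i _|t /= ta i]; exact: ta.
Qed.

(** The [n]-dimensional Lebesgue measure is built one coordinate at a time as
    a product, and a cube is the product of an interval and a cube of lower
    dimension. *)
Lemma lebesgue_tuple_cube_gt0 (R : realType) (n : nat) (a : 'I_n -> R)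
    (e : R) :
  0 < e -> (0 < lebesgue_tuple R n (cube a e))%E.
Proof.
move=> e0; elim: n a => [|n IH] a /=.
  by rewrite diracE mem_set ?lte01// => -[].
rewrite /lebesgue_cons /pushforward.
set c := cube (fun i => a (lift ord0 i)) e.
rewrite (_ : _ @^-1` _ = ball (a ord0) e `*` c).
  rewrite product_measure1E; [|exact: measurable_ball|exact: measurable_cube].
  apply: mule_gt0; last exact: IH.
  have := lebesgue_measure_ball (a ord0) (ltW e0); rewrite /= => ->.
  by rewrite lte_fin mulrn_wgt0.
apply/seteqP; split => [[y t] /= h|[y t] /= [h0 h] i].
  split; first exact: (h ord0).
  by move=> i; have := h (lift ord0 i); rewrite !(tnth_nth 0).
have [j ->|->] := unliftP ord0 i; last exact: h0.
by have := h j; rewrite !(tnth_nth 0).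
Qed.

(** * The surface measure charges open sets *)

(** Continuity arguments take place on row vectors, because the topology of
    the sphere comes from them; this is the counterpart there of [enorm], the
    norm on the tuples that support the Lebesgue measure. *)
Definition row_norm {R : realType} {n : nat} (v : 'rV[R]_n) : R :=
  Num.sqrt (\sum_i v ord0 i ^+ 2).

Lemma row_norm_continuous (R : realType) (n : nat) :
  continuous (@row_norm R n.+1).
Proof.
move=> v.
apply: (@continuous_comp _ _ _
  (fun v : 'rV[R]_n.+1 => \sum_i v ord0 i ^+ 2) Num.sqrt); last first.
  exact: sqrt_continuous.
move: v; apply: continuous_big => [|i _ v]; first exact: add_continuous.
apply: (@continuous_comp _ _ _
  (fun v : 'rV[R]_n.+1 => v ord0 i) (fun y => y ^+ 2)).
  exact: coord_continuous.
exact: exprn_continuous.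
Qed.

(** The radial projection is continuous away from the origin.  The point
    [u / 2] lies over [u] and in the interior of the punctured unit ball, so
    that a whole neighbourhood of it lies in the ball and over [O]. *)
Lemma radial_projection_near (R : realType) (d : nat) (u : sphere R d)
    (O : set 'rV[R]_d.+1) :
  open O -> O (\val u) ->
  \forall v \near (2^-1 *: \val u : 'rV[R]_d.+1),
    0 < row_norm v <= 1 /\ O (\row_i (v ord0 i / row_norm v)).
Proof.
move=> oO Ou; set v0 : 'rV[R]_d.+1 := 2^-1 *: \val u.
have norm_v0 : row_norm v0 = 2^-1.
  rewrite /row_norm; under eq_bigr do rewrite mxE exprMn.
  have -> : \sum_i (2^-1) ^+ 2 * (\val u : 'rV[R]_d.+1) ord0 i ^+ 2 =
      (2^-1) ^+ 2 :> R.
    have /set_mem u1 := valP u.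
    by rewrite -mulr_sumr (_ : \sum_i _ = 1)// mulr1.
  by rewrite sqrtr_sqr ger0_norm.
have cvg_norm : row_norm v @[v --> v0] --> (2^-1 : R).
  by rewrite -[X in _ --> X]norm_v0; exact: row_norm_continuous.
have cvg_proj (i : 'I_d.+1) :
    (v : 'rV[R]_d.+1) ord0 i / row_norm v @[v --> v0] -->
    (\val u : 'rV[R]_d.+1) ord0 i.
  rewrite [X in _ --> X](_ : _ = v0 ord0 i / 2^-1); last first.
    by rewrite mxE invrK mulrC mulrA divff// mul1r.
  apply: (@cvgM _ _ (nbhs v0) _
    (fun v : 'rV[R]_d.+1 => v ord0 i) (fun v => (row_norm v)^-1)).
    exact: coord_continuous.
  by apply: cvgV.
have /nbhs_ballP[e /= e0 eO] : nbhs (\val u) O by exact: open_nbhs_nbhs.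
have near_proj := @filter_forall _ _ _ _ (nbhs_filter v0)
  (fun i => @cvg_ball _ _ _ _ (nbhs_filter v0) _ _ (cvg_proj i) _ e0).
near=> v; split.
  apply/andP; split; near: v.
    by apply: (cvgr_gt (2^-1) cvg_norm); rewrite invr_gt0.
  by apply: (cvgr_le (2^-1) cvg_norm); rewrite invf_lt1// ltr1n.
apply: eO; split => // i j; rewrite ord1 mxE.
by move: j; near: v; exact: near_proj.
Unshelve. all: by end_near.
Qed.

(** The surface measure of [U] is proportional to the volume of the cone over
    [U] in the punctured unit ball, and this cone contains a cube centred at
    [u / 2] for each [u] in [U]. *)
Lemma surface_measure_open_gt0 (R : realType) (d : nat)
    (U : set (sphere R d)) :
  open U -> U !=set0 -> (0 < @surface_measure R d U)%E.
Proof.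
move=> oU [u Uu].
have mU : measurable U by exact: sub_sigma_algebra.
case: oU mU Uu => O oO <- mU Ou.
have /nbhs_ballP[e /= e0 eO] := radial_projection_near R d _ _ oO Ou.
rewrite /surface_measure mule_gt0//.
apply: (lt_le_trans (@lebesgue_tuple_cube_gt0 R d.+1
  ((2^-1 *: \val u : 'rV[R]_d.+1) ord0) e e0)).
apply: le_measure; rewrite ?inE; first exact: measurable_cube.
  apply: measurableI; last exact: measurable_punctured_ball.
  by rewrite -[X in measurable X]setTI; exact: measurable_normalize.
move=> t ct.
have rowE i : (\row_j tnth t j : 'rV[R]_d.+1) ord0 i = tnth t i.
  by rewrite mxE.
have /eO[] : ball (2^-1 *: \val u : 'rV[R]_d.+1) e (\row_i tnth t i).
  by split => // i j; rewrite ord1 rowE; exact: ct.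
have -> : row_norm (\row_i tnth t i) = enorm t.
  by rewrite /row_norm; under eq_bigr do rewrite rowE.
have -> : \row_i ((\row_j tnth t j : 'rV[R]_d.+1) ord0 i / enorm t) =
    \row_i (tnth t i / enorm t) by apply/rowP => i; rewrite !mxE.
move=> t01 Ot; split => //.
suff : O (\val (normalize t)) by [].
(* As [t] is nonzero, [normalize] does not take its default value there. *)
rewrite val_insubd ifT//.
rewrite inE /unit_sphere /=.
have [t0 _] := andP t01.
under eq_bigr do rewrite mxE expr_div_n.
rewrite -mulr_suml sqr_sqrtr ?sumr_ge0// => [|i _]; last exact: sqr_ge0.
by rewrite divff// gt_eqF// -sqrtr_gt0.
Qed.

(** * Mean-square distance of continuous functions on the sphere *)

Lemma cfun_measurable (R : realType) (d : nat) (f : cfun R d) :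
  measurable_fun [set: sphere R d] (f : sphere R d -> R).
Proof.
apply: (measurability _ (RGenOpens.measurableE R)).
move=> _ [_ [a [b ->]] <-]; rewrite setTI.
apply: sub_sigma_algebra.
have /continuousP cf : continuous f by exact: cts_fun.
by apply: cf; exact: interval_open.
Qed.

(** This is Minkowski's inequality for the exponent 2. *)
Lemma integral_sqr_sub_lty (R : realType) (d : nat) (f g : cfun R d) :
  (L2_norm f < +oo)%E -> (L2_norm g < +oo)%E ->
  (\int[@surface_measure R d]_u ((f u - g u) ^+ 2)%:E < +oo)%E.
Proof.
move=> fo go.
have mf := @cfun_measurable R d f.
have mg : measurable_fun [set: sphere R d] (fun u => - g u : R).
  by apply: measurable_funN; exact: cfun_measurable.
have fgo : ('N[@surface_measure R d]_2%:E[
    EFin \o (fun u => f u - g u)%R] < +oo)%E.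
  apply: (le_lt_trans
    (@minkowski_EFin _ _ _ _ f (fun u => - g u) 2 mf mg _)).
    by rewrite ler1n.
  rewrite lte_add_pinfty//.
  by rewrite (_ : EFin \o _ = \- (EFin \o g))%E// oppe_Lnorm.
have := poweR_lty 2 fgo.
rewrite poweR_Lnorm//; apply: le_lt_trans.
rewrite le_eqVlt; apply/orP; left; apply/eqP/eq_integral => v _ /=.
by rewrite powR_mulrn// -normrX ger0_norm// sqr_ge0.
Qed.

(** The set on which [f] and [g] differ is open and of measure zero, hence
    empty. *)
Lemma integral_sqr_sub_eq0 (R : realType) (d : nat) (f g : cfun R d) :
  (L2_norm f < +oo)%E -> (L2_norm g < +oo)%E ->
  \int[@surface_measure R d]_u ((f u - g u) ^+ 2) = 0 -> f = g.
Proof.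
move=> fo go fg0; apply/continuousEP => u.
pose D := fun v => (f v - g v) ^+ 2.
have mD : measurable_fun [set: sphere R d] (D : sphere R d -> R).
  by apply: measurable_funX; apply: measurable_funB; exact: cfun_measurable.
have mED : measurable_fun [set: sphere R d] (EFin \o (D : sphere R d -> R)).
  exact/measurable_EFinP.
have cD : continuous D.
  move=> v.
  apply: (@continuous_comp _ _ _ (fun v => f v - g v) (fun y : R => y ^+ 2)).
    have cf : continuous f by exact: cts_fun.
    have cg : continuous g by exact: cts_fun.
    exact: (cvgB (cf v) (cg v)).
  exact: exprn_continuous.
have : (\int[@surface_measure R d]_v `|(D v)%:E| = 0)%E.
  under eq_integral do rewrite gee0_abs ?lee_fin ?sqr_ge0//.
  (* [fine] maps [+oo] to [0], so [fg0] needs a finite integral. *)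
  rewrite -[LHS]fineK ?[fine _]fg0//.
  rewrite ge0_fin_numE; first exact: integral_sqr_sub_lty.
  by apply: integral_ge0 => v _; rewrite lee_fin sqr_ge0.
move/(ae_eq_integral_abs _ measurableT mED) => D0.
apply/eqP; rewrite -subr_eq0 -sqrf_eq0; apply/negPn/negP => Du.
have oU : open [set v | D v != 0].
  have /continuousP := cD.
  by move=> /(_ [set y | y != 0]); apply; exact: open_neq.
have := @surface_measure_open_gt0 R d _ oU (ex_intro _ u Du).
suff -> : @surface_measure R d [set v | D v != 0] = 0%E by rewrite ltxx.
apply/negligibleP; first exact: sub_sigma_algebra.
apply: negligibleS D0 => v /= Dv /(_ I) [] /eqP.
by rewrite (negbTE Dv).
Qed.

(** * Polynomials and operators *)

Lemma poly_space_le (R : realType) (d m n : nat) :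
  (m <= n)%N -> @poly_space R d m `<=` poly_space n.
Proof. by move=> mn f [p pm pE]; exists p => //; exact: leq_trans pm _. Qed.

Lemma poly_space_sqr_sub (R : realType) (d n : nat) (f g : sphere R d -> R) :
  poly_space n f -> poly_space n g ->
  poly_space (2 * n) (fun u => (f u - g u) ^+ 2).
Proof.
move=> [p pn pE] [q qn qE].
exists ((p - q) * (p - q)); last first.
  by move=> u; rewrite mpoly.mevalM mpoly.mevalB -pE -qE expr2.
have dn : (mpoly.mmeasure mpoly.mdeg (p - q) <= n.+1)%N.
  apply: leq_trans (mpoly.mmeasureD_le _ _ _) _.
  by rewrite mpoly.mmeasureN geq_max pn qn.
(* The size of a product is the sum of the sizes minus one only for nonzero
   factors. *)
have [->|pq0] := eqVneq (p - q) 0; first by rewrite mul0r mpoly.mmeasure0.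
rewrite mpoly.msizeM//; move: dn; set s := mpoly.mmeasure _ _ => sn.
rewrite mul2n -addnn -ltnS; case: s sn => // s; rewrite ltnS => sn.
by rewrite addSn/= addnS !ltnS leq_add.
Qed.

Lemma hyperinterpolation_class_L2_lty (R : realType) (d N : nat)
    (x : 'I_N -> sphere R d) (w : 'I_N -> R)
    (Z : nat -> nat) (Y : forall l : nat, 'I_(Z l) -> cfun R d)
    (T : cfun R d -> cfun R d) (f : cfun R d) :
  hyperinterpolation_class x w Y T -> (L2_norm (T f) < +oo)%E.
Proof.
by case=> n [Phi [_ _ _ [c _ /(_ f)/le_lt_trans]]]; apply; rewrite ltry.
Qed.

(** Expand the square of [a - b] for the discrete form, and take [f] to be
    [a] and then [b]. *)
Lemma discrete_inner_sqr_sub_eq0 (R : realType) (d N : nat)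
    (x : 'I_N -> sphere R d) (w : 'I_N -> R) (a b : cfun R d) :
  (forall f, discrete_inner x w f a = discrete_inner x w f b) ->
  \sum_(j < N) w j * (a (x j) - b (x j)) ^+ 2 = 0.
Proof.
move=> ab.
have : (discrete_inner x w a a - discrete_inner x w a b) -
    (discrete_inner x w b a - discrete_inner x w b b) = 0.
  by rewrite !ab !subrr.
rewrite /discrete_inner -!sumrB => {2}<-; apply: eq_bigr => j _; ring.
Qed.

Theorem theorem4p1 (R : realType) (d : nat) (hd : (2 <= d)%N)
    (Z : nat -> nat) (Y : forall l : nat, 'I_(Z l) -> cfun R d)
    (hY : forall l : nat, orthonormal_harmonic_basis l (Y l))
    (N : nat) (x : 'I_N -> sphere R d) (w : 'I_N -> R)
    (hw : forall j : 'I_N, 0 < w j)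
    (T1 T2 : cfun R d -> cfun R d)
    (hT1 : hyperinterpolation_class x w Y T1)
    (hT2 : hyperinterpolation_class x w Y T2)
    (pT1 : hyper_projection x w T1) (pT2 : hyper_projection x w T2) :
  hyper_projection x w (T1 \o T2) <-> T1 \o T2 = T2 \o T1.
Proof.
have [[s1 i1] [s2 i2]] := (pT1, pT2); split => [[s12 _]|c12]; last first.
  split => [f g|]; first by rewrite /= s1 s2 -[T2 (T1 g)]/((T2 \o T1) g) -c12.
  rewrite -[LHS]/(T1 \o (T2 \o T1) \o T2) -c12.
  by rewrite -[LHS]/((T1 \o T1) \o (T2 \o T2)) i1 i2.
apply/funext => g /=; set a := T1 (T2 g); set b := T2 (T1 g).
have ab f : discrete_inner x w f a = discrete_inner x w f b.
  by rewrite -[a]/((T1 \o T2) g) -s12 /= s1 s2.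
apply: integral_sqr_sub_eq0.
- exact: hyperinterpolation_class_L2_lty hT1.
- exact: hyperinterpolation_class_L2_lty hT2.
have [n1 [_ [e1 P1 _ _]]] := hT1; have [n2 [_ [e2 P2 _ _]]] := hT2.
have [n [en n1n n2n]] :
    exists n, [/\ exactness x w (2 * n), (n1 <= n)%N & (n2 <= n)%N].
  by have [n12|/ltnW n21] := leqP n1 n2; [exists n2|exists n1].
have /en := @poly_space_sqr_sub R d n a b
  (poly_space_le R d n1 n n1n _ (P1 (T2 g)))
  (poly_space_le R d n2 n n2n _ (P2 (T1 g))).
by rewrite discrete_inner_sqr_sub_eq0.
Qed.
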